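(* Let $n\ge3$, let $H\subseteq\mathbb{C}^n$ be an additive subgroup with $\operatorname{span}_{\mathbb{C}}H=\mathbb{C}^n$, and let $0\ne t\in H$. Then $\mathcal M(P(H,t))=0$; that is, the only symmetric bilinear map $m:P(H,t)\times P(H,t)\to P(H,t)$ satisfying $D\,m(x,y)=m(Dx,y)+m(x,Dy)$ for all $D\in\operatorname{Inder}P(H,t)$ and all $x,y\in P(H,t)$ is $m=0$.
   Context: All vector spaces are over $\mathbb{C}$. An $n$-Lie algebra is a vector space $L$ with an alternating $n$-linear bracket satisfying $[x_1,\ldots,x_{n-1},[y_1,\ldots,y_n]]=\sum_{i=1}^n[y_1,\ldots,[x_1,\ldots,x_{n-1},y_i],\ldots,y_n]$. For $x_1,\ldots,x_{n-1}\in L$ put $\operatorname{ad}(x_1,\ldots,x_{n-1})(y)=[x_1,\ldots,x_{n-1},y]$; $\operatorname{Inder}(L)$ is the Lie subalgebra of $\operatorname{End}_{\mathbb{C}}(L)$ spanned by these maps. Define $\mathcal M(L)=\operatorname{Hom}_{\operatorname{Inder}L}(S^2L,L)$, the space of symmetric bilinear maps $m:L\times L\to L$ with $Dm(x,y)=m(Dx,y)+m(x,Dy)$ for all $D\in\operatorname{Inder}L$. $P(H,t)$: put $\Lambda=H\setminus\{0,t\}$. $P(H,t)$ is the $n$-Lie algebra with basis $\{u_a:a\in\Lambda\}$ and bracket $[u_{a_1},\ldots,u_{a_n}]=\det(a_1,\ldots,a_n)\,u_{a_1+\cdots+a_n+t}$, where $u_0=u_t=0$. *)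

(* Defs.v *)
From HB Require Import structures.
From mathcomp Require Import all_boot all_order fingroup perm all_algebra finmap.
From mathcomp Require Import boolp classical_sets functions fsbigop reals.
From mathcomp Require Import complex.
From mathcomp Require Import monalg.

Set Implicit Arguments.
Unset Strict Implicit.
Unset Printing Implicit Defensive.

Import GRing.Theory Num.Theory.
Local Open Scope classical_set_scope.
Local Open Scope ring_scope.

Definition lin_span (K : pzRingType) (V : lmodType K) (A : set V) : set V :=
  [set v | exists (k : nat) (c : 'I_k -> K) (a : 'I_k -> V),
     (forall i, A (a i)) /\ v = \sum_(i < k) c i *: a i].

Definition upd (I : finType) (L : Type) (x : {ffun I -> L}) (i : I) (v : L) :
  {ffun I -> L} := [ffun j => if j == i then v else x j].

(* The tuple (x_1, ..., x_(n-1), y): [insub] fails exactly at the last index. *)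
Definition snoc (n : nat) (L : Type) (x : {ffun 'I_n.-1 -> L}) (y : L) :
  {ffun 'I_n -> L} :=
  [ffun i : 'I_n => oapp x y (insub (val i) : option 'I_n.-1)].

HB.mixin Record isNLie (K : pzRingType) (n : nat) L of GRing.Lmodule K L := {
  nbr : {ffun 'I_n -> L} -> L;
  nbr_linear : forall (x : {ffun 'I_n -> L}) (i : 'I_n) (c : K) (u v : L),
    nbr (upd x i (c *: u + v)) = c *: nbr (upd x i u) + nbr (upd x i v);
  nbr_alternating : forall (x : {ffun 'I_n -> L}) (i j : 'I_n),
    i != j -> x i = x j -> nbr x = 0;
  nbr_filippov : forall (x : {ffun 'I_n.-1 -> L}) (y : {ffun 'I_n -> L}),
    nbr (snoc x (nbr y)) = \sum_(i < n) nbr (upd y i (nbr (snoc x (y i))))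
}.

#[short(type="nLieType")]
HB.structure Definition NLie (K : pzRingType) (n : nat) :=
  { L of isNLie K n L & GRing.Lmodule K L }.

Section Basic.
Variables (K : comNzRingType) (n : nat) (L : nLieType K n).

Definition ad (x : {ffun 'I_n.-1 -> L}) : L -> L := fun y => @nbr K n L (snoc x y).

Definition Inder : set (L -> L) := lin_span (range ad).

Definition calM : set (L -> L -> L) :=
  [set m | [/\ bilinear_for *:%R *:%R m,
               forall x y, m x y = m y x
             & forall D, Inder D ->
                 forall x y, D (m x y) = m (D x) y + m x (D y)]].
End Basic.

Arguments Inder {K n} L.
Arguments calM {K n} L.

Section Multilinear.
Variables (K : nzRingType) (n : nat).

Definition multilinear (L M : lmodType K) (F : {ffun 'I_n -> L} -> M) : Prop :=
  forall x i c u v,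
    F (upd x i (c *: u + v)) = c *: F (upd x i u) + F (upd x i v).

Lemma updE (L : Type) (x : {ffun 'I_n -> L}) i v j :
  upd x i v j = if j == i then v else x j.
Proof. by rewrite ffunE. Qed.

Lemma upd_id (L : Type) (x : {ffun 'I_n -> L}) i : upd x i (x i) = x.
Proof. by apply/ffunP => j; rewrite updE; case: eqP => [->|]. Qed.

Lemma upd_updC (L : Type) (x : {ffun 'I_n -> L}) i j u v :
  i != j -> upd (upd x i u) j v = upd (upd x j v) i u.
Proof.
move=> ij; apply/ffunP => k; rewrite !updE.
by case: (eqVneq k j) => // ->; rewrite eq_sym (negbTE ij).
Qed.

Lemma upd_upd (L : Type) (x : {ffun 'I_n -> L}) i u v :
  upd (upd x i u) i v = upd x i v.
Proof. by apply/ffunP => k; rewrite !updE; case: eqP. Qed.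

Lemma multilinear0 (L M : lmodType K) (F : {ffun 'I_n -> L} -> M) x i :
  multilinear F -> F (upd x i 0) = 0.
Proof.
move=> FL; have := FL x i 1 0 0; rewrite scaler0 addr0 scale1r => /eqP.
by rewrite -subr_eq0 opprD addNKr oppr_eq0 => /eqP.
Qed.

Lemma multilinearZ (L M : lmodType K) (F : {ffun 'I_n -> L} -> M) x i c u :
  multilinear F -> F (upd x i (c *: u)) = c *: F (upd x i u).
Proof.
by move=> FL; rewrite -[c *: u]addr0 FL (multilinear0 _ _ FL) addr0.
Qed.

Lemma multilinear_sum (L M : lmodType K) (F : {ffun 'I_n -> L} -> M)
    (T : Type) (r : seq T) (c : T -> K) (u : T -> L) x i :
  multilinear F ->
  F (upd x i (\sum_(k <- r) c k *: u k)) =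
  \sum_(k <- r) c k *: F (upd x i (u k)).
Proof.
move=> FL; elim: r => [|k r IH]; first by rewrite !big_nil multilinear0.
by rewrite !big_cons FL IH.
Qed.

Lemma multilinear_eq0 (T : choiceType) (M : lmodType K)
    (F : {ffun 'I_n -> {malg K[T]}} -> M) :
  multilinear F -> (forall a : {ffun 'I_n -> T}, F [ffun i => << a i >>] = 0) ->
  forall x, F x = 0.
Proof.
move=> FL F0.
suff H k : (k <= n)%N -> forall x : {ffun 'I_n -> {malg K[T]}},
    (forall i : 'I_n, (k <= i)%N -> exists b, x i = << b >>) -> F x = 0.
  by move=> x; apply: (H n) => // i; rewrite leqNgt ltn_ord.
elim: k => [_ x xb|k IH kn x xb].
  have {}xb i : exists b, x i == << b >>.
    by have [b ->] := xb i (leq0n _); exists b.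
  rewrite -(F0 [ffun i => xchoose (xb i)]); congr F; apply/ffunP => i.
  by rewrite !ffunE; apply/eqP/(xchooseP (xb i)).
pose i0 := Ordinal kn.
rewrite -(upd_id x i0) (monalgE (x i0)).
have -> : \sum_(b <- msupp (x i0)) << (x i0)@_b *g b >> =
          \sum_(b <- msupp (x i0)) (x i0)@_b *: << b >>.
  apply: eq_bigr => b _; apply/malgP => b'.
  by rewrite mcoeffZ !mcoeffU mulrnAr mulr1.
rewrite multilinear_sum// big1 // => b _.
rewrite IH ?scaler0 // 1?ltnW // => i ki; rewrite updE.
case: eqP => [_|/eqP ne]; first by exists b.
by apply: xb; rewrite ltn_neqAle ki andbT eq_sym.
Qed.

End Multilinear.

Section Snoc.
Variables (n : nat) (L : Type).

Lemma snoc_lt (x : {ffun 'I_n.-1 -> L}) y (i : 'I_n) (j : 'I_n.-1) :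
  val i = val j -> snoc x y i = x j.
Proof. by move=> ij; rewrite ffunE ij valK. Qed.

Lemma snoc_last (x : {ffun 'I_n.-1 -> L}) y (i : 'I_n) :
  val i = n.-1 -> snoc x y i = y.
Proof. by move=> ij; rewrite ffunE insubF //= ij ltnn. Qed.

Lemma snocP (i : 'I_n) : (exists j : 'I_n.-1, val i = val j) \/ val i = n.-1.
Proof.
have := ltn_ord i; case: (ltnP i n.-1) => [lt _|ge lt].
  by left; exists (Ordinal lt).
right; apply/eqP; rewrite eqn_leq ge andbT.
by rewrite -ltnS (ltn_predK lt).
Qed.

Lemma snoc_updl (x : {ffun 'I_n.-1 -> L}) y j v :
  snoc (upd x j v) y = upd (snoc x y) (widen_ord (leq_pred n) j) v.
Proof.
apply/ffunP => i; rewrite updE.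
case: (snocP i) => [[k ik]|il].
  by rewrite !(snoc_lt _ _ ik) updE -!val_eqE /= ik.
rewrite !(snoc_last _ _ il); case: eqP => // ij.
by have := ltn_ord j; move: il; rewrite ij /= => {2}<-; rewrite ltnn.
Qed.

Lemma snoc_updr (x : {ffun 'I_n.-1 -> L}) y y' (l : 'I_n) :
  val l = n.-1 -> snoc x y' = upd (snoc x y) l y'.
Proof.
move=> ll; apply/ffunP => i; rewrite updE.
case: (snocP i) => [[k ik]|il].
  rewrite !(snoc_lt _ _ ik); case: eqP => // il.
  by have := ltn_ord k; move: ll; rewrite -il ik => {2}<-; rewrite ltnn.
have -> : i = l by apply: val_inj; rewrite ll -il.
by rewrite eqxx snoc_last.
Qed.

End Snoc.

Lemma snoc_map (n : nat) (L L' : Type) (f : L -> L') (x : {ffun 'I_n.-1 -> L}) y :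
  [ffun i => f (snoc x y i)] = snoc [ffun i => f (x i)] (f y).
Proof.
apply/ffunP => i; rewrite ffunE.
case: (snocP i) => [[k ik]|il]; first by rewrite (snoc_lt _ _ ik) (snoc_lt _ _ ik) ffunE.
by rewrite (snoc_last _ _ il) (snoc_last _ _ il).
Qed.

Section Det.
Variables (K : comNzRingType) (n : nat).
Implicit Types (a b : {ffun 'I_n -> 'rV[K]_n}) (w : 'rV[K]_n).

Definition detf a : K := \det (\matrix_(i < n) a i).

Lemma detf_upd b i w :
  detf (upd b i w) = (w *m \adj (\matrix_(j < n) b j)) 0 i.
Proof.
rewrite /detf (expand_det_row _ i) !mxE; apply: eq_bigr => j _.
rewrite !mxE updE eqxx; congr (_ * _); congr (_ * \det _).
by apply/matrixP => k l; rewrite !mxE updE -[_ == i]negbK eq_sym neq_lift.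
Qed.

Lemma detf_linear b i c w w' :
  detf (upd b i (c *: w + w')) = c * detf (upd b i w) + detf (upd b i w').
Proof. by rewrite !detf_upd mulmxDl -scalemxAl !mxE. Qed.

Lemma detf_upd0 b i : detf (upd b i 0) = 0.
Proof. by rewrite detf_upd mul0mx mxE. Qed.

Lemma detf_cramer b w : \sum_i detf (upd b i w) *: b i = detf b *: w.
Proof.
rewrite -mul_mx_scalar -mul_adj_mx mulmxA [RHS]mulmx_sum_row.
by apply: eq_bigr => i _; rewrite detf_upd rowK.
Qed.

Lemma detf_sum0 b : (0 < n)%N -> \sum_i b i = 0 -> detf b = 0.
Proof.
move=> n0 b0; pose i0 := Ordinal n0.
have E : b i0 = - \sum_(i | i != i0) b i.
  by apply/eqP; rewrite -addr_eq0; move: b0; rewrite (bigD1 i0) //= => ->.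
rewrite -(upd_id b i0) E -sumrN detf_upd mulmx_suml summxE big1 // => i ii.
rewrite -detf_upd -scaleN1r -[_ *: _]addr0 detf_linear detf_upd0 addr0.
rewrite /detf (determinant_alternate (i1 := i) (i2 := i0)) ?mulr0 // => j.
by rewrite !mxE !updE eqxx (negbTE ii).
Qed.

End Det.

Section PHtDef.
Variables (K : numFieldType) (n : nat).
Variables (H : zmodClosed 'rV[K]_n) (t : 'rV[K]_n).

Definition inLam (a : 'rV[K]_n) : bool := [&& a \in H, a != 0 & a != t].

Definition Lam := {a : 'rV[K]_n | inLam a}.
HB.instance Definition _ := Choice.on Lam.

Definition PHt : Type := {malg K[Lam]}.
HB.instance Definition _ := GRing.Lmodule.copy PHt {malg K[Lam]}.

Definition uvec (a : Lam) : PHt := << a >>.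

(* u_a for a in Lam, and 0 otherwise; in particular u_0 = u_t = 0. *)
Definition ubas (a : 'rV[K]_n) : PHt :=
  oapp uvec 0 (insub a : option Lam).

Definition brbas (a : {ffun 'I_n -> Lam}) : PHt :=
  \det (\matrix_(i < n) val (a i)) *: ubas (\sum_(i < n) val (a i) + t).

(* The n-linear extension of brbas; only finitely many terms are nonzero. *)
Definition brPHt (x : {ffun 'I_n -> PHt}) : PHt :=
  \sum_(a \in [set: {ffun 'I_n -> Lam}])
    (\prod_(i < n) (x i : {malg K[Lam]})@_(a i)) *: brbas a.

Definition tupf (D : {fset Lam}) : {fset {ffun 'I_n -> Lam}} :=
  [fset ([ffun i => val (g i)] : {ffun 'I_n -> Lam}) | g : {ffun 'I_n -> D} in predT]%fset.

Lemma mem_tupf D (a : {ffun 'I_n -> Lam}) :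
  (forall i, a i \in D) -> a \in tupf D.
Proof.
move=> aD; apply/imfsetP => /=; exists [ffun i => FSetSub (aD i)] => //.
by apply/ffunP => i; rewrite !ffunE.
Qed.

Lemma brPHt_tupf (D : {fset Lam}) (x : {ffun 'I_n -> PHt}) :
  (forall i, msupp (x i : {malg K[Lam]}) `<=` D)%fset ->
  brPHt x = \sum_(a <- tupf D)
    (\prod_(i < n) (x i : {malg K[Lam]})@_(a i)) *: brbas a.
Proof.
move=> xD; rewrite /brPHt (fsbigTE (tupf D)) // => a aD.
have [i iD] : exists i, a i \notin D.
  apply/existsP; rewrite -negb_forall; apply: contra aD => /forallP aD.
  exact: mem_tupf.
rewrite (bigD1 i) //= mcoeff_outdom ?mul0r ?scale0r //.
by apply: contra iD; apply/fsubsetP/xD.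
Qed.

Lemma brPHt_linear : multilinear brPHt.
Proof.
move=> x i c u v.
pose D := (msupp (c *: u + v : {malg K[Lam]}) `|`
   (msupp (u : {malg K[Lam]}) `|` (msupp (v : {malg K[Lam]}) `|`
    \bigcup_(j <- enum 'I_n) msupp (x j : {malg K[Lam]}))))%fset.
have xD j : (msupp (x j : {malg K[Lam]}) `<=` D)%fset.
  apply/fsubsetP => b bx; rewrite !inE; do 3 (apply/orP; right).
  by apply/bigfcupP; exists j => //; rewrite mem_enum.
have updD w : (msupp (w : {malg K[Lam]}) `<=` D)%fset ->
    forall j, (msupp (upd x i w j : {malg K[Lam]}) `<=` D)%fset.
  by move=> wD j; rewrite updE; case: eqP.
rewrite !(@brPHt_tupf D); first last.
- by apply: updD; apply/fsubsetP => b bx; rewrite !inE bx.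
- by apply: updD; apply/fsubsetP => b bx; rewrite !inE bx !orbT.
- by apply: updD; apply/fsubsetP => b bx; rewrite !inE bx !orbT.
rewrite scaler_sumr -big_split /=; apply: eq_bigr => a _.
move: (brbas a) => e; rewrite scalerA -scalerDl; congr (_ *: _).
rewrite !(bigD1 i (P := xpredT)) //= !updE eqxx.
have E w : \prod_(j | j != i) (upd x i w j : {malg K[Lam]})@_(a j) =
           \prod_(j | j != i) (x j : {malg K[Lam]})@_(a j).
  by apply: eq_bigr => j ji; rewrite updE (negbTE ji).
by rewrite !E mulrA -mulrDl mcoeffD mcoeffZ.
Qed.

Lemma brPHt_bas (a : {ffun 'I_n -> Lam}) :
  brPHt [ffun i => uvec (a i)] = brbas a.
Proof.
rewrite /brPHt (fsbigTE [fset a]%fset).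
  rewrite big_seq_fset1 big1 ?scale1r // => i _.
  by rewrite ffunE mcoeffUU.
move=> b; rewrite inE => ba.
have [i iD] : exists i, a i != b i.
  apply/existsP; rewrite -negb_forall; apply: contra ba => /forallP ab.
  by apply/eqP/ffunP => i; rewrite (eqP (ab i)).
rewrite (bigD1 i) //= ffunE mcoeffU (negbTE iD) mul0r scale0r //.
Qed.

Lemma brPHt_eq0 (M : lmodType K) (F : {ffun 'I_n -> PHt} -> M) :
  multilinear F ->
  (forall a : {ffun 'I_n -> Lam},
     F [ffun i => uvec (a i)] = 0) ->
  forall x, F x = 0.
Proof. exact: multilinear_eq0. Qed.

Lemma ubasE (a : Lam) : ubas (val a) = uvec a.
Proof. by rewrite /ubas valK. Qed.

Lemma ubas0 (a : 'rV[K]_n) : ~~ inLam a -> ubas a = 0.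
Proof. by move=> aN; rewrite /ubas insubN. Qed.

#[local] Opaque brPHt ubas uvec.

Lemma brPHt_alternating (x : {ffun 'I_n -> PHt}) (i j : 'I_n) :
  i != j -> x i = x j -> brPHt x = 0.
Proof.
move=> ij xij.
pose swap T (z : {ffun 'I_n -> T}) := [ffun k => z (tperm i j k)].
suff S z : brPHt z + brPHt (swap _ z) = 0.
  have := S x; have -> : swap _ x = x.
    apply/ffunP => k; rewrite ffunE.
    by case: tpermP => [->|->|]; rewrite ?xij.
  rewrite -mulr2n -scaler_nat => /eqP; rewrite scaler_eq0 pnatr_eq0 /=.
  by move/eqP.
have swapU T (y : {ffun _ -> T}) k (w : T) :
    swap _ (upd y k w) = upd (swap _ y) (tperm i j k) w.
  apply/ffunP => l; rewrite !ffunE.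
  by rewrite (canF_eq (tpermK i j)).
move: z; apply: brPHt_eq0.
  move=> z k c u v; rewrite !swapU !brPHt_linear scalerDr.
  by rewrite addrACA.
move=> a.
have -> : swap _ [ffun k => uvec (a k)] =
          [ffun k => uvec (swap _ a k)] :> {ffun 'I_n -> PHt}.
  by apply/ffunP => k; rewrite [LHS]ffunE [LHS]ffunE [RHS]ffunE /swap ffunE.
have E1 := brPHt_bas a; have E2 := brPHt_bas (swap _ a).
rewrite [X in X + _]E1 E2 {E1 E2} /brbas.
have -> : \matrix_(k < n) val (swap _ a k) =
          row_perm (tperm i j) (\matrix_(k < n) val (a k)).
  by apply/matrixP => k l; rewrite !mxE ffunE.
have -> : \sum_(k < n) val (swap _ a k) = \sum_(k < n) val (a k).
  rewrite [RHS](reindex_inj (@perm_inj _ (tperm i j))).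
  by apply: eq_bigr => k _; rewrite ffunE.
rewrite row_permE det_mulmx det_perm odd_tperm ij expr1 mulN1r scaleNr.
exact: subrr.
Qed.

Lemma brPHt_ubas (a : {ffun 'I_n -> 'rV[K]_n}) :
  (forall i, inLam (a i)) ->
  brPHt [ffun i => ubas (a i)] = detf a *: ubas (\sum_i a i + t).
Proof.
move=> aL; pose b : {ffun 'I_n -> Lam} := [ffun i => exist _ (a i) (aL i)].
have ab i : a i = val (b i) by rewrite ffunE.
have -> : [ffun i => ubas (a i)] =
    [ffun i => uvec (b i)] :> {ffun 'I_n -> PHt}.
  by apply/ffunP => i; rewrite [LHS]ffunE [RHS]ffunE ab ubasE.
rewrite brPHt_bas /brbas /detf.
have -> : \matrix_(i < n) val (b i) = \matrix_(i < n) a i.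
  by apply/matrixP => k l; rewrite !mxE ab.
by congr (_ *: ubas (_ + _)); apply: eq_bigr => i _; rewrite ab.
Qed.

Lemma brPHt_slot (a : {ffun 'I_n -> 'rV[K]_n}) i c w :
  (forall j, j != i -> inLam (a j)) -> w \in H -> (w = t -> c = 0) ->
  brPHt (upd [ffun j => ubas (a j)] i (c *: ubas w)) =
  (c * detf (upd a i w)) *: ubas (\sum_j upd a i w j + t).
Proof.
move=> aL wH wt; rewrite multilinearZ; last exact: brPHt_linear.
have [/wt ->|wnt] := eqVneq w t; first by rewrite mul0r !scale0r.
have [->|wn0] := eqVneq w 0.
  rewrite ubas0 ?/inLam ?eqxx ?andbF // multilinear0; last exact: brPHt_linear.
  by rewrite detf_upd0 mulr0 scale0r scaler0.
have -> : upd [ffun j => ubas (a j)] i (ubas w) = [ffun j => ubas (upd a i w j)].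
  by apply/ffunP => j; rewrite updE !ffunE; case: ifP.
rewrite brPHt_ubas ?scalerA // => j; rewrite updE.
by case: ifP => [_|/negbT/aL //]; rewrite /inLam wH wn0.
Qed.

Lemma brPHt_tN : t \notin H -> forall x, brPHt x = 0.
Proof.
move=> tN; apply: brPHt_eq0; first exact: brPHt_linear.
move=> a; rewrite brPHt_bas /brbas ubas0 ?scaler0 // /inLam.
rewrite rpredDl ?(negbTE tN) // rpred_sum // => i _.
by case/and3P: (valP (a i)).
Qed.

End PHtDef.

#[local] Opaque brPHt ubas uvec detf.

Lemma sum_snoc (V : zmodType) (m : nat) (x : {ffun 'I_m.+1.-1 -> V}) y :
  \sum_(i < m.+1) snoc x y i = \sum_j x j + y.
Proof.
rewrite big_ord_recr /= (@snoc_last m.+1 _ _ _ ord_max) //; congr (_ + _).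
by apply: eq_bigr => j _; rewrite (@snoc_lt m.+1 _ _ _ _ j).
Qed.

Lemma brPHt_filippov (K : numFieldType) (n : nat) (H : zmodClosed 'rV[K]_n)
    (t : 'rV[K]_n)
    (x : {ffun 'I_n.-1 -> PHt H t}) (y : {ffun 'I_n -> PHt H t}) :
  brPHt (snoc x (brPHt y)) =
  \sum_(i < n) brPHt (upd y i (brPHt (snoc x (y i)))).
Proof.
have [tH|tN] := boolP (t \in H); last first.
  by rewrite !brPHt_tN // big1 // => i _; rewrite brPHt_tN.
case: n H t tH x y => [|m] H t tH x y.
  rewrite big_ord0; move: (snoc _ _); apply: brPHt_eq0.
    exact: brPHt_linear.
  move=> a; rewrite brPHt_bas /brbas big_ord0 add0r ubas0 ?scaler0 //.
  by rewrite /inLam eqxx !andbF.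
apply/eqP; rewrite -subr_eq0; apply/eqP.
have lin := @brPHt_linear K m.+1 H t.
have adr x' c u v : brPHt (snoc x' (c *: u + v)) =
    c *: brPHt (snoc x' u) + brPHt (snoc x' v) :> PHt H t.
  have snl z : snoc x' z = upd (snoc x' 0) ord_max z by exact: snoc_updr.
  by rewrite (snl (c *: u + v)) (snl u) (snl v) lin.
have adl (x' : {ffun 'I_m -> PHt H t}) k c u v z :
    brPHt (snoc (upd x' k (c *: u + v) : {ffun 'I_m.+1.-1 -> PHt H t}) z) =
    c *: brPHt (snoc (upd x' k u : {ffun 'I_m.+1.-1 -> PHt H t}) z) +
    brPHt (snoc (upd x' k v : {ffun 'I_m.+1.-1 -> PHt H t}) z).
  by rewrite !(@snoc_updl m.+1) lin.
move: y; apply: brPHt_eq0 => [y k c u v|b].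
  rewrite lin adr scalerBr addrACA -opprD; congr (_ - _).
  rewrite scaler_sumr -big_split; apply: eq_bigr => i _ /=.
  have [->|ik] := eqVneq i k; first by rewrite !upd_upd !updE eqxx adr lin.
  by rewrite !updE (negbTE ik) !(upd_updC _ _ _ (i := k)) 1?eq_sym // lin.
move: x; apply: (@multilinear_eq0 _ m) => [x k c u v|a].
  rewrite adl scalerBr addrACA -opprD; congr (_ - _).
  rewrite scaler_sumr -big_split; apply: eq_bigr => i _ /=.
  by rewrite adl lin.
pose A : {ffun 'I_m.+1.-1 -> 'rV[K]_m.+1} := [ffun i => val (a i)].
pose B : {ffun 'I_m.+1 -> 'rV[K]_m.+1} := [ffun i => val (b i)].
have AL i : inLam H t (A i) by rewrite ffunE; exact: valP.
have BL i : inLam H t (B i) by rewrite ffunE; exact: valP.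
have AH i : A i \in H by case/and3P: (AL i).
have BH i : B i \in H by case/and3P: (BL i).
pose S := \sum_i A i; pose T := \sum_i B i.
have SH : S \in H by exact: rpred_sum.
have TH : T \in H by exact: rpred_sum.
pose uA : {ffun 'I_m.+1.-1 -> PHt H t} := [ffun i => ubas H t (A i)].
pose uB : {ffun 'I_m.+1 -> PHt H t} := [ffun i => ubas H t (B i)].
have -> : [ffun i => uvec (a i)] = uA.
  by apply/ffunP => i; rewrite !ffunE ubasE.
have -> : [ffun i => uvec (b i)] = uB.
  by apply/ffunP => i; rewrite !ffunE ubasE.
pose phi w := detf (snoc A w).
have phiE w : phi w = detf (upd (snoc A 0) ord_max w).
  by rewrite /phi (@snoc_updr _ _ A 0 w ord_max).
have phiL c w w' : phi (c *: w + w') = c * phi w + phi w'.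
  by rewrite !phiE detf_linear.
have phi0 : phi 0 = 0 by rewrite phiE detf_upd0.
have phiZ c w : phi (c *: w) = c * phi w.
  by rewrite -[c *: w]addr0 phiL phi0 addr0.
have phiD w w' : phi (w + w') = phi w + phi w'.
  by rewrite -[w]scale1r phiL mul1r scale1r.
have phiS : phi S = 0.
  have : phi (- S) = 0 by rewrite /phi detf_sum0 // sum_snoc subrr.
  by rewrite -scaleN1r phiZ mulN1r => /eqP; rewrite oppr_eq0 => /eqP.
have phi_sum (c : 'I_m.+1 -> K) (w : 'I_m.+1 -> 'rV[K]_m.+1) :
    phi (\sum_i c i *: w i) = \sum_i c i * phi (w i).
  rewrite (big_morph phi phiD phi0); apply: eq_bigr => i _; exact: phiZ.
have adE c w : w \in H -> (w = t -> c = 0) ->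
    brPHt (snoc uA (c *: ubas H t w)) = (c * phi w) *: ubas H t (S + w + t).
  move=> wH wt.
  have -> : snoc uA (c *: ubas H t w) =
      upd [ffun j => ubas H t (snoc A 0 j)] ord_max (c *: ubas H t w).
    by rewrite snoc_map; exact: snoc_updr.
  have AsL j : j != ord_max -> inLam H t (snoc A 0 j).
    move=> jm; case: (snocP j) => [[k jk]|jl].
      by rewrite (snoc_lt _ _ jk); exact: AL.
    by case/eqP: jm; apply: val_inj.
  rewrite (brPHt_slot AsL wH wt) phiE.
  have <- : snoc A w = upd (snoc A 0) ord_max w by exact: snoc_updr.
  by rewrite sum_snoc.
have -> : brPHt uB = detf B *: ubas H t (T + t) by exact: brPHt_ubas.
have TtH : T + t \in H by rewrite rpredD.
have Tt : T + t = t -> detf B = 0.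
  by move=> /eqP; rewrite -subr_eq0 addrK => /eqP T0; exact: detf_sum0.
rewrite (adE _ _ TtH Tt).
have E i : brPHt (upd uB i (brPHt (snoc uA (uB i)))) =
    (phi (B i) * (detf (upd B i (S + t)) + detf B)) *: ubas H t (S + (T + t) + t).
  have -> : uB i = 1 *: ubas H t (B i) by rewrite scale1r ffunE.
  have Bt : B i = t -> (1 : K) = 0.
    by move=> Bt; case/and3P: (BL i); rewrite Bt eqxx.
  rewrite (adE _ _ (BH i) Bt) mul1r.
  have wH : S + B i + t \in H by rewrite !rpredD.
  have wt : S + B i + t = t -> phi (B i) = 0.
    move=> /eqP; rewrite -subr_eq0 addrK => /eqP SB.
    by move/(congr1 phi): SB; rewrite phiD phiS add0r phi0.
  rewrite (brPHt_slot (fun j _ => BL j) wH wt).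
  have -> : detf (upd B i (S + B i + t)) = detf (upd B i (S + t)) + detf B.
    rewrite -[S + B i + t]addrA [B i + t]addrC addrA.
    by rewrite -[S + t]scale1r detf_linear mul1r scale1r upd_id.
  have -> // : \sum_j upd B i (S + B i + t) j = S + (T + t).
  rewrite (bigD1 i) //= updE eqxx.
  have -> : \sum_(j | j != i) upd B i (S + B i + t) j = T - B i.
    rewrite /T [in RHS](bigD1 i) //= [B i + _]addrC addrK.
    by apply: eq_bigr => j ji; rewrite updE (negbTE ji).
  rewrite -[S + B i + t]addrA [B i + t]addrC addrA [T - B i]addrC addrA addrK.
  by rewrite [T + t]addrC addrA.
have C : \sum_i phi (B i) * (detf (upd B i (S + t)) + detf B) =
    detf B * phi (T + t).
  have -> : \sum_i phi (B i) * (detf (upd B i (S + t)) + detf B) =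
      \sum_i detf (upd B i (S + t)) * phi (B i) + \sum_i detf B * phi (B i).
    rewrite -big_split; apply: eq_bigr => i _ /=.
    by rewrite mulrC mulrDl.
  rewrite -phi_sum detf_cramer phiZ -mulr_sumr -mulrDr phiD phiS add0r.
  by rewrite [T + t]addrC phiD /T (big_morph phi phiD phi0).
by rewrite (eq_bigr _ (fun i _ => E i)) -scaler_suml C subrr.
Qed.

Section PHtInstance.
Variables (K : numFieldType) (n : nat).
Variables (H : zmodClosed 'rV[K]_n) (t : 'rV[K]_n).

HB.instance Definition _ := isNLie.Build K n (PHt H t)
  (@brPHt_linear K n H t) (@brPHt_alternating K n H t)
  (@brPHt_filippov K n H t).
End PHtInstance.

(* Main.v *)
(** Let u_a be the basis of P(H,t), let m lie in M(P(H,t)) and let F a b w be the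
  coefficient of u_w in m(u_a, u_b).  An inner derivation
  ad(u_(x_1), ..., u_(x_(n-1))) with x_1 + ... + x_(n-1) = c - t acts by
  u_b |-> phi(b) u_(b+c), where phi(b) = det(x_1, ..., x_(n-1), b) kills c - t.
  Since H spans, such determinants separate points modulo the line K(c - t), so
  invariance of m says that
    F a b w w - F (a+c) b (w+c) a - F a (b+c) (w+c) b  lies in K(c - t).
  For c = 0 this gives w = a + b + k t whenever F a b w <> 0.  If a, b, t are
  independent, c = -a (where u_0 = 0) gives (1 - k) F = 0 and c = a + t gives
  k F = 0, so F a b w = 0.  The dependent cases are reduced to this one by moving
  a and b by some c in H outside the span of b and t. *)
Require Import Defs.
From HB Require Import structures.
From mathcomp Require Import all_boot all_order all_algebra.
From mathcomp Require Import boolp classical_sets functions reals complex.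
From mathcomp Require Import monalg ring.
Set Implicit Arguments.
Unset Strict Implicit.
Unset Printing Implicit Defensive.
Import GRing.Theory Num.Theory.
Local Open Scope classical_set_scope.
Local Open Scope ring_scope.
Local Open Scope complex_scope.

(** * Linear algebra: avoidance, extension of free families, determinants with prescribed row sum *)

(** In characteristic 0 each [i] excludes at most one [k], so any [k] beyond all excluded values
    works. *)
Lemma exists_nat_avoiding_multiples (K : numFieldType) (V : lmodType K)
    (I : finType) (y z : I -> V) :
  (forall i, y i != 0) ->
  exists2 k : nat, (0 < k)%N & forall i, k%:R *: y i != z i.
Proof.
move=> y0; have fP i : exists l : nat, forall k, k%:R *: y i = z i -> k = l.
  have [[l lz]|nl] := pselect (exists l : nat, l%:R *: y i = z i); last first.
    by exists 0%N => k kz; case: nl; exists k.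
  exists l => k /eqP; rewrite -lz -subr_eq0 -scalerBl scaler_eq0.
  by rewrite (negbTE (y0 i)) orbF subr_eq0 eqr_nat => /eqP.
pose f i := sval (cid (fP i)).
exists (\max_i f i).+1 => // i; apply/eqP => /(svalP (cid (fP i))) kf.
by have := leq_bigmax (F := f) i; rewrite /f -kf ltnn.
Qed.

Lemma exists_functional (K : fieldType) (V : vectType K) (X : seq V)
    (r : nat -> K) :
  free X ->
  exists phi : {scalar V}, forall i, (i < size X)%N -> phi X`_i = r i.
Proof.
move=> Xf; pose f (v : V) := \sum_(j < size X) r j * coord (in_tuple X) j v.
have fL : scalar f.
  move=> c v w; rewrite /f mulr_sumr -big_split; apply: eq_bigr => j _ /=.
  by rewrite linearP mulrDr mulrCA.
pose phi : {scalar V} := HB.pack f (GRing.isLinear.Build K V K *%R f fL).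
exists phi => i iX; rewrite /= /f (bigD1 (Ordinal iX)) //= big1 ?addr0.
  by rewrite (coord_free (Ordinal iX) (Ordinal iX)) // eqxx mulr1.
move=> j ji; rewrite (coord_free (Ordinal iX) j) //.
by rewrite eq_sym (negbTE ji) mulr0.
Qed.

Lemma linear_eq0 (K : pzRingType) (V W : lmodType K) (f : V -> W) :
  linear f -> f 0 = 0.
Proof.
by move=> fL; have := fL (-1) 0 0; rewrite scaler0 addr0 scaleN1r addNr.
Qed.

Lemma linear_scale (K : pzRingType) (V W : lmodType K) (f : V -> W) :
  linear f -> forall c x, f (c *: x) = c *: f x.
Proof.
by move=> fL c x; rewrite -[c *: x]addr0 fL (linear_eq0 fL) addr0.
Qed.

Lemma linear_sym_bilinear_scale (K : pzRingType) (V : lmodType K)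
    (f : V -> K) (m : V -> V -> V) :
  (forall c x y, f (c *: x + y) = c * f x + f y) ->
  (forall y, linear (m^~ y)) -> (forall x y, m x y = m y x) ->
  forall p q x y x' y',
  f (m (p *: x) y + m x' (q *: y')) = p * f (m x y) + q * f (m x' y').
Proof.
move=> fL mL mC p q x y x' y'; have f0 : f 0 = 0.
  by have := fL (-1) 0 0; rewrite scaler0 addr0 mulN1r addNr.
rewrite (linear_scale (mL y)) fL [m x' (_ *: _)]mC (linear_scale (mL x')).
by rewrite -[q *: _]addr0 fL f0 addr0 [m y' _]mC.
Qed.

Section SpanningSubset.
Variables (K : fieldType) (n : nat) (A : set 'rV[K]_n).
Hypothesis A_span : lin_span A = setT.

Lemma exists_notin_vspace (U : {vspace 'rV[K]_n}) :
  (\dim U < n)%N -> exists2 c, A c & c \notin U.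
Proof.
move=> dU; apply: contrapT => nc.
have AU c : A c -> c \in U.
  by move=> Ac; apply: contrapT => /negP cU; apply: nc; exists c.
suff /dimvS : (fullv <= U)%VS.
  by rewrite dimvf dim_matrix mul1r leqNgt dU.
apply/subvP => v _; have : lin_span A v by rewrite A_span.
by case=> k [c [a [Aa ->]]]; apply: rpred_sum => i _; rewrite rpredZ ?AU.
Qed.

(** Each new vector is taken in [A] outside the span so far. Independence is stated modulo the span
    of [X], so that one relation yields both its part [v] in the span and its coefficients [c i]. *)
Lemma extend_free (X : seq 'rV[K]_n) p :
  free X -> (size X + p = n)%N ->
  exists e : {ffun 'I_p -> 'rV[K]_n}, (forall i, A (e i)) /\
    forall (c : 'I_p -> K) v, v \in <<X>>%VS ->
      v + \sum_i c i *: e i = 0 -> v = 0 /\ forall i, c i = 0.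
Proof.
elim: p X => [|p IH] X Xf Xn.
  exists [ffun _ => 0]; split=> [[]//|c v vX].
  by rewrite big_ord0 addr0 => ->; split=> // -[].
have [|a Aa aX] := @exists_notin_vspace <<X>>%VS.
  by rewrite (eqP Xf) -[ltnRHS]Xn addnS ltnS leq_addr.
have [||e [Ae ef]] := IH (a :: X); first by rewrite free_cons aX.
  by rewrite /= addSn -addnS.
exists [ffun i => oapp e a (unlift ord0 i)]; split.
  by move=> i; rewrite ffunE; case: unliftP => [j|] _ /=.
move=> c v vX; rewrite big_ord_recl ffunE unlift_none /= addrA.
under eq_bigr => i _ do rewrite ffunE liftK /=.
move=> /ef [|va0 c0].
  rewrite span_cons addrC; apply: memv_add => //.
  by apply/rpredZ/memv_line.
have c00 : c ord0 = 0.
  apply: contraNeq aX => c00; move/eqP: va0; rewrite addr_eq0 => /eqP va.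
  have -> : a = - (c ord0)^-1 *: v.
    by rewrite va scalerN scaleNr opprK scalerA mulVf ?scale1r.
  by rewrite rpredZ.
split; first by move: va0; rewrite c00 scale0r addr0.
by move=> i; case: (unliftP ord0 i) => [j ->|-> //].
Qed.

End SpanningSubset.

(* The witness is k e_1, ..., k e_(n-2), s - k (e_1 + ... + e_(n-2)), where the
   e_i in H complete v, s to a basis and k is chosen so that t is avoided. *)
Lemma exists_snoc_det_neq0 (K : numFieldType) (n : nat)
    (H : zmodClosed 'rV[K]_n) (t s v : 'rV[K]_n) :
  (3 <= n)%N -> lin_span [set` H] = setT -> t \in H ->
  s \in H -> s != 0 -> v \notin <[s]>%VS ->
  exists x : {ffun 'I_n.-1 -> 'rV[K]_n},
    [/\ forall i, inLam H t (x i), \sum_i x i = s & detf (snoc x v) != 0].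
Proof.
case: n H t s v => [|[|[|p]]] // H t s v _ Hs tH sH s0 vs.
have vsf : free [:: v; s] by rewrite free_cons seq1_free s0 span_seq1 vs.
have [|e [eH ef]] := @extend_free _ _ _ Hs _ p.+1 vsf; first by [].
have {}eH i : e i \in H by exact: eH.
have s_in : s \in <<[:: v; s]>>%VS by rewrite memv_span ?inE ?eqxx ?orbT.
have sum_neq w (c : 'I_p.+1 -> K) : w \in <<[:: v; s]>>%VS -> w != 0 ->
    w + \sum_i c i *: e i != 0.
  by move=> wX w0; apply: contra_neq w0 => /ef -/(_ wX) [].
have e0 i : e i != 0.
  apply/eqP => ei; have [|_ /(_ i)] := ef (fun j => (j == i)%:R) 0 (mem0v _).
    rewrite add0r (bigD1 i) //= ei scaler0 add0r big1 // => j ji.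
    by rewrite (negbTE ji) scale0r.
  by rewrite eqxx => /eqP; rewrite oner_eq0.
have se0 : \sum_i e i != 0.
  apply/eqP => ei; have [|_ /(_ ord0)/eqP] := ef (fun=> 1) 0 (mem0v _).
    by rewrite add0r -[RHS]ei; apply: eq_bigr => j _; rewrite scale1r.
  by rewrite oner_eq0.
(* [Some i] keeps the multiple of [e i] away from [t]; [None] keeps the last entry [r] away from
   [t]. *)
have [k k0 kP] := @exists_nat_avoiding_multiples K _ (option 'I_p.+1)
  (fun o => oapp e (\sum_i e i) o) (fun o => oapp (fun=> t) (s - t) o)
  (fun o => match o with Some i => e0 i | None => se0 end).
pose y : {ffun 'I_p.+2.-1 -> 'rV[K]_p.+3} := [ffun i => k%:R *: e i].
have ysum : \sum_i y i = k%:R *: \sum_i e i.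
  by rewrite scaler_sumr; apply: eq_bigr => i _; rewrite ffunE.
have kn0 : k%:R != 0 :> K by rewrite pnatr_eq0 -lt0n.
pose r := s - k%:R *: \sum_i e i.
exists (@snoc p.+2 _ y r); split.
- move=> i; case: (snocP i) => [[j ij]|il].
    rewrite (snoc_lt _ _ ij) ffunE /inLam scaler_eq0 (negbTE kn0) (negbTE (e0 j)).
    by rewrite (kP (Some j)) scaler_nat rpredMn.
  rewrite (snoc_last _ _ il) /inLam rpredB ?scaler_nat ?rpredMn ?rpred_sum //=.
  apply/andP; split.
    have := sum_neq s (fun=> - k%:R) s_in s0.
    by rewrite -scaler_sumr scaleNr.
  apply: contraNneq (kP None) => /= rt.
  by rewrite -rt /r opprB addrC subrK.
- by rewrite (sum_snoc y) ysum addrC subrK.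
apply/det0P => -[u u0 uM]; move/negP: u0; apply.
have : \sum_i u 0 i *: snoc (@snoc p.+2 _ y r : {ffun 'I_p.+3.-1 -> _}) v i = 0.
  rewrite -[RHS]uM mulmx_sum_row; apply: eq_bigr => i _.
  by congr (_ *: _); apply/rowP => j; rewrite !mxE.
pose o1 : 'I_p.+3 := widen_ord (leqnSn _) ord_max.
rewrite big_ord_recr big_ord_recr /= -/o1.
rewrite (@snoc_last p.+3 _ _ _ ord_max (erefl _)).
rewrite (@snoc_lt p.+3 _ _ _ o1 (ord_max : 'I_p.+2) (erefl _)).
rewrite (@snoc_last p.+2 _ _ _ ord_max (erefl _)).
set u1 := u 0 o1; set u2 := u 0 ord_max.
move=> E.
(* In the row relation [u], the coefficients of [r] and [v] are [u1] and [u2]. Expanding [r] leaves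
   [u1 *: s + u2 *: v] plus the sum of the [d i *: e i], to which [ef] applies. *)
pose d (i : 'I_p.+1) : K :=
  k%:R * (u 0 (widen_ord (leqnSn _) (widen_ord (leqnSn _) i)) - u1).
have [||us d0] := ef d (u1 *: s + u2 *: v).
- by rewrite rpredD ?rpredZ // memv_span ?inE ?eqxx.
- rewrite -[RHS]E [LHS]addrAC; congr (_ + _).
  rewrite /r scalerBr [RHS]addrCA; congr (_ + _).
  rewrite 2!scaler_sumr -sumrB.
  apply: eq_bigr => i _.
  rewrite (@snoc_lt p.+3 _ _ _ _ (widen_ord (leqnSn _) i)) //.
  rewrite (@snoc_lt p.+2 _ _ _ _ i) // ffunE.
  by rewrite -scalerBl scalerA mulrC.
have u2_0 : u2 = 0.
  apply: contraNeq vs => u2_0; apply/vlineP; exists (- (u2^-1 * u1)).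
  move/eqP: us; rewrite addrC addr_eq0 => /eqP /(congr1 ( *:%R u2^-1)).
  by rewrite scalerA mulVf // scale1r scalerN scalerA scaleNr.
have u1_0 : u1 = 0.
  move/eqP: us; rewrite u2_0 scale0r addr0 scaler_eq0 (negbTE s0) orbF.
  by move/eqP.
apply/eqP/rowP => i; rewrite mxE.
case: (@snocP p.+3 i) => [[j ij]|il]; last first.
  by rewrite -[RHS]u2_0; congr (u 0 _); apply: val_inj.
case: (@snocP p.+2 j) => [[l jl]|jl]; last first.
  by rewrite -[RHS]u1_0; congr (u 0 _); apply: val_inj; rewrite ij jl.
have /eqP := d0 l; rewrite /d u1_0 subr0 mulf_eq0 (negbTE kn0) /= => /eqP <-.
by congr (u 0 _); apply: val_inj; rewrite ij jl.
Qed.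

Lemma sum_snoc_pos (V : zmodType) n (x : {ffun 'I_n.-1 -> V}) y :
  (0 < n)%N -> \sum_i snoc x y i = \sum_i x i + y.
Proof. by case: n x => // m x _; exact: sum_snoc. Qed.

(** * Coefficients in the basis u_a and the action of inner derivations on them *)

Section Coefficients.
Variables (K : numFieldType) (n : nat) (H : zmodClosed 'rV[K]_n) (t : 'rV[K]_n).
Local Notation L := (PHt H t).
Local Notation u := (ubas H t).
Local Notation inL := (inLam H t).

Lemma PHt_linear_eq0 (M : lmodType K) (f : L -> M) :
  linear f -> (forall a, inL a -> f (u a) = 0) -> forall x, f x = 0.
Proof.
move=> fL fu x.
(* A linear map is a multilinear map with one slot, so [multilinear_eq0] applies. *)
pose F (y : {ffun 'I_1 -> {malg K[Lam H t]}}) : M := f (y ord0).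
have FL : multilinear F.
  by move=> y i c v w; rewrite /F !updE (ord1 i) eqxx fL.
have := @multilinear_eq0 _ _ _ _ F FL _ [ffun=> x]; rewrite /F ffunE; apply.
by move=> a; rewrite ffunE; have := fu _ (valP (a ord0)); rewrite ubasE.
Qed.

(** Extended by 0 outside Lambda, so that shifted indices such as [w - c] always make sense. *)
Definition ucoef (x : L) (w : 'rV[K]_n) : K :=
  oapp (fun l : Lam H t => (x : {malg K[Lam H t]})@_l) 0 (insub w).

Lemma ucoef_linear w c x y : ucoef (c *: x + y) w = c * ucoef x w + ucoef y w.
Proof.
rewrite /ucoef; case: insub => [l|] /=; last by rewrite mulr0 addr0.
by rewrite mcoeffD mcoeffZ.
Qed.

Lemma ucoef0 w : ucoef 0 w = 0.
Proof. by rewrite /ucoef; case: insub => //= l; rewrite mcoeff0. Qed.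

Lemma ucoefZ w c x : ucoef (c *: x) w = c * ucoef x w.
Proof. by rewrite -[c *: x]addr0 ucoef_linear ucoef0 addr0. Qed.

Lemma ucoef_out x w : ~~ inL w -> ucoef x w = 0.
Proof. by move=> wN; rewrite /ucoef insubN. Qed.

Lemma ucoef_ubas a w : inL a -> ucoef (u a) w = (a == w)%:R.
Proof.
move=> aL; have [wL|wN] := boolP (inL w); last first.
  by rewrite ucoef_out //; case: eqP wN => [<-|//]; rewrite aL.
rewrite /ucoef /ubas !insubT /= mcoeffU; congr (_ %:R).
Qed.

Lemma ucoef_inj x : (forall w, ucoef x w = 0) -> x = 0.
Proof.
move=> x0; apply/malgP => l; have := x0 (val l).
by rewrite /ucoef valK /= mcoeff0.
Qed.

(* Otherwise failing unifications unfold the bracket and do not terminate. *)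
#[local] Opaque brPHt ubas uvec detf ucoef.

(** Only u_(w-c) can contribute at [w]. For [w] outside Lambda the left side is 0 while the right
    side need not be, hence the hypothesis [inL w]. *)
Lemma ucoef_shift (D : L -> L) (phi : 'rV[K]_n -> K) c y w :
  linear D -> (forall b, inL b -> D (u b) = phi b *: u (b + c)) -> inL w ->
  ucoef (D y) w = phi (w - c) * ucoef y (w - c).
Proof.
move=> DL Du wL; apply/eqP; rewrite -subr_eq0; apply/eqP.
pose f (z : L) : K^o := ucoef (D z) w - phi (w - c) * ucoef z (w - c).
apply: (@PHt_linear_eq0 _ f) => [k y1 y2|a aL]; rewrite /f.
  rewrite DL !ucoef_linear -[k *: _]/(k * _).
  by rewrite mulrBr mulrDr opprD addrACA mulrCA.
rewrite Du // ucoefZ [ucoef (u a) _]ucoef_ubas //.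
have [->|ne] := eqVneq a (w - c).
  by rewrite subrK ucoef_ubas // eqxx subrr.
rewrite mulr0 subr0.
have [acL|acN] := boolP (inL (a + c)); last by rewrite ubas0 // ucoef0 mulr0.
rewrite ucoef_ubas //; case: eqP => [acw|]; last by rewrite mulr0.
by rewrite -acw addrK eqxx in ne.
Qed.

Section Ad.
Variables (x : {ffun 'I_n.-1 -> 'rV[K]_n}).
Hypotheses (n_gt0 : (0 < n)%N) (xL : forall i, inL (x i)).
Let D := ad ([ffun i => u (x i)] : {ffun 'I_n.-1 -> (L : nLieType K n)}).

Lemma ad_linear : linear D.
Proof.
move=> c v w; have lt : (n.-1 < n)%N by rewrite ltn_predL.
pose ux : {ffun 'I_n.-1 -> L} := [ffun i => u (x i)].
have DE z : D z = brPHt (upd (snoc ux 0) (Ordinal lt) z).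
  by rewrite -(@snoc_updr n L ux 0 z (Ordinal lt) (erefl _)).
by rewrite !DE brPHt_linear.
Qed.

Lemma ad_ubas b : inL b ->
  D (u b) = detf (snoc x b) *: u (b + (\sum_i x i + t)).
Proof.
move=> bL; rewrite /D /ad -snoc_map.
transitivity (detf (snoc x b) *: u (\sum_i snoc x b i + t)).
  apply: brPHt_ubas => i; case: (snocP i) => [[j ij]|il].
    by rewrite (snoc_lt _ _ ij).
  by rewrite (snoc_last _ _ il).
have E : \sum_i snoc x b i + t = b + (\sum_i x i + t).
  by rewrite (sum_snoc_pos x b n_gt0) [_ + b]addrC addrA.
by rewrite E.
Qed.

End Ad.
End Coefficients.

(** * Invariance as a relation between structure constants *)

Section InvariantProducts.
Variables (K : numFieldType) (n : nat) (H : zmodClosed 'rV[K]_n) (t : 'rV[K]_n).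
Hypotheses (n_ge3 : (3 <= n)%N) (H_span : lin_span [set` H] = setT).
Hypothesis tH : t \in H.
Local Notation L := (PHt H t).
Local Notation u := (ubas H t).
Local Notation inL := (inLam H t).

Lemma Inder_ad (x : {ffun 'I_n.-1 -> (L : nLieType K n)}) :
  Inder (L : nLieType K n) (ad x).
Proof.
exists 1%N, (fun=> 1), (fun=> ad x); split; first by move=> _; exists x.
by rewrite big_ord1 scale1r.
Qed.

Variable m : L -> L -> L.
Hypothesis mM : calM (L : nLieType K n) m.

Lemma calM_sym x y : m x y = m y x. Proof. by case: mM. Qed.

Lemma calM_linearl y : linear (m^~ y).
Proof. by case: mM => -[ml _] _ _ c x z; exact: ml. Qed.

Definition str a b w := @ucoef K n H t (m (u a) (u b)) w.

Lemma strC a b w : str a b w = str b a w.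
Proof. by rewrite /str calM_sym. Qed.

Lemma m0l y : m 0 y = 0.
Proof. exact: (linear_eq0 (calM_linearl y)). Qed.

Lemma str_outl a b w : ~~ inL a -> str a b w = 0.
Proof. by move=> aN; rewrite /str ubas0 // m0l ucoef0. Qed.

(** If [v] were off the line, a tuple with sum [c - t] would give a determinant functional nonzero
    at [v]; comparing coefficients at [w + c] in the invariance of [m] shows that it vanishes
    there. *)
Lemma str_line a b c w :
  inL a -> inL b -> c \in H -> c != t -> inL (w + c) ->
  str a b w *: w - str (a + c) b (w + c) *: a - str a (b + c) (w + c) *: b
    \in <[c - t]>%VS.
Proof.
move=> aL bL cH ct wcL; set v := (X in X \in _).
apply: contraT => vN; have n_gt0 : (0 < n)%N by rewrite (ltn_trans _ n_ge3).
have [||x [xL xs]] := @exists_snoc_det_neq0 K n H t (c - t) v n_ge3 H_span tH _ _ vN.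
- by rewrite rpredB.
- by rewrite subr_eq0.
move/eqP; case.
pose phi z := detf (snoc x z).
have phiL k y z : phi (k *: y + z) = k * phi y + phi z.
  have lt : (n.-1 < n)%N by rewrite ltn_predL.
  rewrite /phi (@snoc_updr _ _ x 0 (_ + _) (Ordinal lt)) // detf_linear.
  by rewrite -!(@snoc_updr _ _ x 0 _ (Ordinal lt)).
pose ux : {ffun 'I_n.-1 -> L} := [ffun i => u (x i)].
have DL : linear (ad (ux : {ffun 'I_n.-1 -> (L : nLieType K n)})).
  exact: ad_linear.
have Du b' : inL b' ->
    ad (ux : {ffun 'I_n.-1 -> (L : nLieType K n)}) (u b') = phi b' *: u (b' + c).
  move=> b'L; have -> : c = \sum_i x i + t by rewrite xs subrK.
  exact: ad_ubas.
have Dm y z := let: And3 _ _ h := mM in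
  h _ (Inder_ad (ux : {ffun 'I_n.-1 -> (L : nLieType K n)})) y z.
(* From here only linearity, the action on the basis and the invariance of [m] are used, so the
   bracket is abstracted away. *)
move: (ad _) DL Du Dm => D DL Du Dm.
have E : phi w * str a b w =
    phi a * str (a + c) b (w + c) + phi b * str a (b + c) (w + c).
  have <- : @ucoef K n H t (D (m (u a) (u b))) (w + c) = phi w * str a b w.
    by rewrite (ucoef_shift (phi := phi) _ DL Du wcL) (addrK c w).
  rewrite Dm (Du a aL) (Du b bL).
  exact: (linear_sym_bilinear_scale (ucoef_linear (w + c))
    calM_linearl calM_sym).
have phi0 : phi 0 = 0.
  by have := phiL (-1) 0 0; rewrite scaler0 addr0 mulN1r addNr.
have phiZ k y : phi (k *: y) = k * phi y by rewrite -[k *: y]addr0 phiL phi0 addr0.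
rewrite -/(phi v) /v -addrA -!scaleNr phiL phiL phiZ [_ * phi w]mulrC E.
by ring.
Qed.

End InvariantProducts.

(** * Vanishing of the structure constants *)

(** Linear independence in dual form. It passes to modified triples by solving for the values to
    prescribe on the original one. *)
Definition dual_triple (K : fieldType) (V : vectType K) (a b t : V) :=
  forall x y z : K, exists phi : {scalar V}, [/\ phi a = x, phi b = y & phi t = z].

Lemma free_dual_triple (K : fieldType) (V : vectType K) (a b t : V) :
  free [:: a; b; t] -> dual_triple a b t.
Proof.
move=> fr x y z.
have [phi phiP] := exists_functional (nth 0 [:: x; y; z]) fr.
by exists phi; split; [apply: (phiP 0) | apply: (phiP 1) | apply: (phiP 2)].
Qed.

Section StructureConstants.
Variables (K : numFieldType) (n : nat) (H : zmodClosed 'rV[K]_n) (t : 'rV[K]_n).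
Hypotheses (n_ge3 : (3 <= n)%N) (H_span : lin_span [set` H] = setT).
Hypotheses (tH : t \in H) (t_neq0 : t != 0).
Local Notation V := 'rV[K]_n.
Local Notation inL := (inLam H t).

Variable F : V -> V -> V -> K.
Hypothesis FC : forall a b w, F a b w = F b a w.
Hypothesis F_outl : forall a b w, ~~ inL a -> F a b w = 0.
Hypothesis F_out : forall a b w, ~~ inL w -> F a b w = 0.
Hypothesis F_line : forall a b c w,
  inL a -> inL b -> c \in H -> c != t -> inL (w + c) ->
  F a b w *: w - F (a + c) b (w + c) *: a - F a (b + c) (w + c) *: b
    \in <[c - t]>%VS.

(** A functional with [phi c = phi t] kills the line in [F_line], leaving a scalar identity. *)
Lemma F_functional (phi : {scalar V}) a b c w :
  inL a -> inL b -> c \in H -> c != t -> inL (w + c) -> phi c = phi t ->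
  phi w * F a b w =
    phi a * F (a + c) b (w + c) + phi b * F a (b + c) (w + c).
Proof.
move=> aL bL cH ct wL phic; have /vlineP[k] := F_line aL bL cH ct wL.
move=> /(congr1 phi); rewrite [RHS]linearZ !linearB !linearZ /= phic subrr mulr0.
move/eqP; rewrite -addrA -opprD subr_eq0 mulrC => /eqP ->.
by congr (_ + _); rewrite mulrC.
Qed.

Lemma inLam0 : ~~ inL 0. Proof. by rewrite /inLam eqxx !andbF. Qed.

Lemma F_neq0_inLam a b w : F a b w != 0 -> [/\ inL a, inL b & inL w].
Proof.
move=> F0; split; apply: contraNT F0 => ?.
- by rewrite F_outl.
- by rewrite FC F_outl.
- by rewrite F_out.
Qed.

Lemma F_weight a b w : F a b w != 0 -> exists k, w = a + b + k *: t.
Proof.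
move=> F0; have [aL bL wL] := F_neq0_inLam F0.
have := F_line (c := 0) (w := w) aL bL; rewrite !addr0 rpred0 sub0r => /(_ isT).
rewrite eq_sym => /(_ t_neq0 wL) /vlineP[k].
rewrite -!scalerBr => /(congr1 ( *:%R (F a b w)^-1)).
rewrite scalerA mulVf // scale1r => /eqP; rewrite -addrA -opprD subr_eq addrC.
by move/eqP => ->; exists (- ((F a b w)^-1 * k)); rewrite scaleNr !scalerN scalerA.
Qed.

Lemma exists_notin_span (X : seq V) :
  (size X < n)%N -> exists2 c, c \in H & c \notin <<X>>%VS.
Proof.
move=> Xn; apply: (exists_notin_vspace H_span).
exact: leq_ltn_trans (dim_span X) Xn.
Qed.

Lemma F_eq0_indep a b w : dual_triple a b t -> F a b w = 0.
Proof.
move=> dual; apply/eqP; apply: contraT => F0.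
have [aL bL wL] := F_neq0_inLam F0.
have [k wE] := F_weight F0.
(* [phib] is 1 on [w] and on its translates along [a] and [t], but 0 on 0 and [t]; this certifies
   that those translates in [H] lie in Lambda. *)
have [phib [pba pbb pbt]] := dual 0 1 0.
have aH : a \in H by case/and3P: aL.
have wH : w \in H by case/and3P: wL.
have inL1 z : z \in H -> phib z = 1 -> inL z.
  move=> zH z1; rewrite /inLam zH /=; apply/andP; split; apply/eqP => zE.
    by move/eqP: z1; rewrite zE linear0 eq_sym oner_eq0.
  by move/eqP: z1; rewrite zE pbt eq_sym oner_eq0.
have pbw : phib w = 1.
  by rewrite wE !linearD linearZ /= pba pbb pbt mulr0 add0r addr0.
(* Take [c = - a]. The values give [phi c = phi t = -1]; the first term has index 0 and the second
   has factor [phi b = 0]. *)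
have E1 : (1 - k) * F a b w = 0.
  have [phi [pa pb pt]] := dual 1 0 (-1).
  have := @F_functional phi a b (- a) w aL bL.
  rewrite rpredN aH subrr (F_outl _ _ inLam0) pb mul0r mulr0 addr0.
  have -> : phi w = 1 - k.
    by rewrite wE !linearD linearZ /= pa pb pt mulrN1 addr0.
  apply=> //.
  - have [psi [sa _ st]] := dual 1 0 0.
    apply/eqP => /(congr1 psi)/eqP.
    by rewrite linearN /= sa st oppr_eq0 oner_eq0.
  - by apply: inL1; [rewrite rpredB | rewrite linearB /= pbw pba subr0].
  - by rewrite linearN /= pa pt.
(* Take [c = a + t]. Then [phi c = phi t = 1], and both terms on the right have factor 0. *)
have E2 : k * F a b w = 0.
  have [phi [pa pb pt]] := dual 0 0 1.
  have := @F_functional phi a b (a + t) w aL bL.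
  rewrite rpredD // pa pb !mul0r addr0.
  have -> : phi w = k.
    by rewrite wE !linearD linearZ /= pa pb pt mulr1 !add0r.
  apply=> //.
  - by rewrite -subr_eq0 addrK; case/and3P: aL.
  - apply: inL1; first by rewrite !rpredD.
    by rewrite !linearD /= pbw pba pbt !addr0.
  - by rewrite linearD /= pa pt add0r.
by move: F0; rewrite -[F a b w]mul1r -(subrK k 1) mulrDl E1 E2 addr0 eqxx.
Qed.

Lemma inLam_notin_line a : a \in H -> a \notin <[t]>%VS -> inL a.
Proof.
move=> aH at_; rewrite /inLam aH /=; apply/andP; split; apply: contraNneq at_.
  by move=> ->; exact: mem0v.
by move=> ->; exact: memv_line.
Qed.

(** In the dependent case [a = s *: b + nu *: t]. Translations by [c] off the span of [b] and [t]
    relate [F a b w] to constants of independent triples; they force [nu = 1], then [s = -1], then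
    [w = 0], which is not in Lambda. *)
Lemma F_eq0_notin_line a b w : b \notin <[t]>%VS -> F a b w = 0.
Proof.
move=> bt; apply/eqP; apply: contraT => F0.
have [aL bL wL] := F_neq0_inLam F0.
have fbt : free [:: b; t] by rewrite free_cons seq1_free t_neq0 span_seq1 bt.
have [aH bH wH] : [/\ a \in H, b \in H & w \in H].
  by split; [case/and3P: aL | case/and3P: bL | case/and3P: wL].
have [abt|abt] := boolP (a \in <<[:: b; t]>>%VS); last first.
  by move: F0; rewrite F_eq0_indep ?eqxx //; apply: free_dual_triple; rewrite free_cons abt.
have [s [nu aE]] : exists s nu, a = s *: b + nu *: t.
  move: abt; rewrite span_cons span_seq1 => /memv_addP[_ /vlineP[s ->]].
  by move=> [_ /vlineP[nu ->]] ->; exists s, nu.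
have [|c cH cbt] := @exists_notin_span [:: b; t]; first exact: n_ge3.
have dual : dual_triple c b t by apply: free_dual_triple; rewrite free_cons cbt.
have notin (phi : {scalar V}) z : phi t = 0 -> phi z != 0 -> z \notin <[t]>%VS.
  move=> pt; apply: contraNN => /vlineP[k ->].
  by rewrite linearZ /= pt mulr0.
have ct : c != t.
  have [phi [pc _ pt]] := dual 1 0 0.
  by apply/eqP => /(congr1 phi)/eqP; rewrite pc pt oner_eq0.
(* Translating from [a - c] makes [F a b w] the first term on the right, with factor
   [phi (a - c) = nu - 1]. [psi] is nonzero on [a - c] and 0 on [t], which puts [a - c] in
   Lambda. *)
have nu1 : nu = 1.
  have [phi [pc pb pt]] := dual 1 0 1.
  have [psi [sc sb st]] := dual 1 0 0.
  have acL : inL (a - c).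
    apply: inLam_notin_line; first by rewrite rpredB.
    apply: (notin psi) => //.
    by rewrite aE linearB linearD !linearZ /= sc sb st !mulr0 addr0 sub0r oppr_eq0 oner_eq0.
  have := @F_functional phi (a - c) b c (w - c) acL bL cH ct.
  rewrite !subrK pc pt => /(_ wL erefl).
  rewrite (@F_eq0_indep (a - c) b) ?mulr0; last first.
    move=> x y z; have [xi [xc xb xt]] := dual (s * y + nu * z - x) y z.
    exists xi; split=> //.
    by rewrite aE linearB linearD !linearZ /= xb xt xc; ring.
  rewrite pb mul0r addr0 => /esym/eqP; rewrite mulf_eq0 (negbTE F0) orbF.
  rewrite aE linearB linearD !linearZ /= pc pb pt mulr0 add0r mulr1 subr_eq0.
  by move/eqP.
have {nu nu1}aE : a = s *: b + t by rewrite aE nu1 scale1r.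
have s0 : s != 0.
  by apply/eqP => s0; case/and3P: aL => _ _ /eqP[]; rewrite aE s0 scale0r add0r.
(* Now the translation starts from [b - c]. The value [- s^-1] at [b] makes [phi a = 0], so
   [F a b w] survives alone with factor [- s^-1 - 1]. *)
have sN1 : s = -1.
  have [phi [pc pb pt]] := dual 1 (- s^-1) 1.
  have [psi [sc sb st]] := dual 1 0 0.
  have bcL : inL (b - c).
    apply: inLam_notin_line; first by rewrite rpredB.
    by apply: (notin psi); rewrite // linearB /= sb sc sub0r oppr_eq0 oner_eq0.
  have := @F_functional phi a (b - c) c (w - c) aL bcL cH ct.
  rewrite !subrK pc pt => /(_ wL erefl).
  rewrite (@F_eq0_indep a (b - c)) ?mulr0; last first.
    move=> x y z.
    have [xi [xc xb xt]] := dual (s^-1 * (x - z) - y) (s^-1 * (x - z)) z.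
    exists xi; split=> //.
      by rewrite aE linearD !linearZ /= xb xt mulVKf // subrK.
    by rewrite linearB /= xb xc; ring.
  have -> : phi a = 0.
    by rewrite aE linearD !linearZ /= pb pt mulrN mulfV // addNr.
  rewrite mul0r add0r => /esym/eqP; rewrite mulf_eq0 (negbTE F0) orbF.
  rewrite linearB /= pb pc -opprD oppr_eq0 addr_eq0 => /eqP s1.
  by rewrite -[s]invrK s1 invrN invr1.
have {s s0 sN1}aE : a = t - b by rewrite aE sN1 scaleN1r addrC.
have [k wE] := F_weight F0.
have {}wE : w = (1 + k) *: t by rewrite wE aE subrK scalerDl scale1r.
(* This time [F a b w] is on the left with factor [phi w = 1 + k], so [k = -1] and [w = 0]. *)
have [phi [pc pb pt]] := dual 1 0 1.
have [psi [sc sb st]] := dual 1 0 0.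
have wcL : inL (w + c).
  apply: inLam_notin_line; first by rewrite rpredD.
  apply: (notin psi) => //.
  by rewrite wE linearD linearZ /= sc st mulr0 add0r oner_eq0.
have := @F_functional phi a b c w aL bL cH ct wcL.
rewrite pc pt => /(_ erefl).
rewrite (@F_eq0_indep (a + c) b) ?mulr0; last first.
  move=> x y z; have [xi [xc xb xt]] := dual (x - z + y) y z.
  by exists xi; split=> //; rewrite aE linearD linearB /= xc xb xt; ring.
rewrite pb mul0r addr0 => /eqP; rewrite mulf_eq0 (negbTE F0) orbF.
rewrite {1}wE linearZ /= pt mulr1 => /eqP k0.
by case/and3P: wL; rewrite wE k0 scale0r eqxx.
Qed.

(** If [a] and [b] both lie on the line of [t], translating from [a - c] with [c] off the line
    relates [F a b w] to constants with an index off the line. Its factor [phi a - 1] must vanish,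
    so [a = t], which is not in Lambda. *)
Lemma F_eq0 a b w : F a b w = 0.
Proof.
have [at_|] := boolP (a \in <[t]>%VS); last by rewrite FC; exact: F_eq0_notin_line.
have [bt|] := boolP (b \in <[t]>%VS); last exact: F_eq0_notin_line.
apply/eqP; apply: contraT => F0.
have [aL bL wL] := F_neq0_inLam F0.
have [|c cH] := @exists_notin_span [:: t]; first exact: ltn_trans n_ge3.
rewrite span_seq1 => ct.
have fct : free [:: c; t] by rewrite free_cons seq1_free t_neq0 span_seq1 ct.
have [phi phiP] := exists_functional (nth 0 [:: 1; 1]) fct.
have pc : phi c = 1 := phiP 0 isT; have pt : phi t = 1 := phiP 1 isT.
have acN : a - c \notin <[t]>%VS.
  by apply: contra ct => acN; rewrite -[c](subKr a) rpredB.
have bcN : b + c \notin <[t]>%VS.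
  by apply: contra ct => bcN; rewrite -[c](addKr b) addrC rpredB.
have acL : inL (a - c).
  by apply: inLam_notin_line => //; rewrite rpredB //; case/and3P: aL.
have cnt : c != t by apply: contraNneq ct => ->; exact: memv_line.
have := @F_functional phi (a - c) b c (w - c) acL bL cH cnt.
rewrite !subrK pc pt => /(_ wL erefl).
rewrite (@F_eq0_notin_line _ (b + c)) // mulr0 addr0 FC F_eq0_notin_line // mulr0.
move/esym/eqP; rewrite mulf_eq0 (negbTE F0) orbF linearB /= pc subr_eq0.
case/vlineP: at_ => k aE; rewrite aE linearZ /= pt mulr1 => /eqP k1.
by case/and3P: aL => _ _; rewrite aE k1 scale1r eqxx.
Qed.

End StructureConstants.

(** * From basis vectors to all products, and invariance of the zero product *)

Lemma Inder_eq0 (K : comNzRingType) n (L : nLieType K n) (D : L -> L) :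
  (0 < n)%N -> Inder L D -> D 0 = 0.
Proof.
move=> n_gt0 [k [c [E [adE ->]]]].
rewrite fct_sumE big1 // => i _; have [x _ <-] := adE i.
have lt : (n.-1 < n)%N by rewrite ltn_predL.
rewrite -[LHS]/(c i *: ad x 0) /ad.
rewrite (@snoc_updr _ _ _ 0 _ (Ordinal lt)) //.
by rewrite (multilinear0 _ _ (@nbr_linear K n L)) scaler0.
Qed.

Lemma calM_PHt_eq0 (K : numFieldType) (n : nat) (H : zmodClosed 'rV[K]_n)
    (t : 'rV[K]_n) (m : PHt H t -> PHt H t -> PHt H t) :
  (3 <= n)%N -> lin_span [set` H] = setT -> t \in H -> t != 0 ->
  calM (PHt H t : nLieType K n) m -> forall x y, m x y = 0.
Proof.
move=> n3 Hs tH t0 mM.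
have ml y : linear (m^~ y) by exact: calM_linearl mM y.
have mC x y : m x y = m y x by exact: calM_sym mM x y.
have m_ubas a b : m (ubas H t a) (ubas H t b) = 0.
  apply: ucoef_inj => w; apply: (F_eq0 n3 Hs tH t0 (F := str m)).
  - exact: strC mM.
  - exact: str_outl mM.
  - by move=> ? ? ? ?; exact: ucoef_out.
  - exact: str_line n3 Hs tH m mM.
move=> x y; apply: (PHt_linear_eq0 (ml y)) => a _ {x}.
rewrite mC; apply: (PHt_linear_eq0 (ml _)) => b _ {y}.
exact: m_ubas.
Qed.

Unset Implicit Arguments.

Theorem theorem4p2 (R : realType) (n : nat)
    (H : zmodClosed 'rV[R[i]]_n) (t : 'rV[R[i]]_n) :
  (3 <= n)%N ->
  lin_span [set` H] = setT ->
  t \in H -> t != 0 ->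
  calM (PHt H t : nLieType R[i] n) = [set (fun _ _ => 0)].
Proof.
move=> n3 Hs tH t0; apply/seteqP; split=> m.
  by move=> mM; apply/funext => x; apply/funext => y; exact: calM_PHt_eq0 mM x y.
move=> ->; split=> [|//|D DI x y].
  by split=> x c y z; rewrite /= scaler0 addr0.
by rewrite addr0; apply: Inder_eq0 DI; exact: leq_trans n3.
Qed.
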